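(* Let $w\in\mathcal V$ be the weak solution of Problem $\mathcal P^s_Q$ with datum $g\in L^2(\Omega)$ and let $\mathbf p:=t^{1-2s}\nabla_{xt}w$ be its flux. For any $\widetilde w\in\mathcal V$ and any $\mathbf y\in Y^s_g$, setting ${\rm e}_w:=\widetilde w-w$ and $\mathbf e_{\mathbf p}:=\mathbf y-\mathbf p$, it holds $$|||\nabla_{xt}{\rm e}_w|||^2+|||t^{2s-1}\mathbf e_{\mathbf p}|||^2=|||\nabla_{xt}\widetilde w-t^{2s-1}\mathbf y|||^2.$$
   Context: $\Omega\subset\mathbb R^d$, $d\ge1$, is a bounded connected open set with Lipschitz boundary, $0<s<1$, $Q:=\Omega\times(0,+\infty)$, $\Gamma:=\partial\Omega\times(0,+\infty)$. Points of $Q$ are $(x,t)$, $\nabla_{xt}w=\{\nabla_xw,w_t\}$, and ${\rm div}_{xt}$ is the (distributional) divergence in all $d+1$ variables. For scalar or vector functions on $Q$, $|||v|||^2:=\int_Q t^{1-2s}|v|^2\,dxdt$. The space $\mathcal V$ is the closure of smooth functions on $\overline Q$ with bounded support vanishing on $\Gamma$ with respect to the norm $|||\nabla_{xt}w|||$; $w(\cdot,0)$ denotes the trace of $w\in\mathcal V$ on $\Omega\times\{0\}$. Problem $\mathcal P^s_Q$: for given $g\in L^2(\Omega)$ find $w\in\mathcal V$ with $w_{tt}+\frac{1-2s}{t}w_t+\Delta_xw=0$ in $Q$, $-\lim_{t\to0+}t^{1-2s}w_t=g$ in $\Omega$, $w=0$ on $\Gamma$, understood weakly: $$\int_Q t^{1-2s}\nabla_{xt}w\cdot\nabla_{xt}\eta\,dxdt-\int_\Omega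 g\,\eta(x,0)\,dx=0\qquad\forall\eta\in\mathcal V.$$ Fluxes: $Y^s$ is the set of vector functions $\mathbf y=\{y_1,\dots,y_{d+1}\}$ on $Q$ with $\int_Q t^{2s-1}|\mathbf y|^2\,dxdt<\infty$ (that is, $|||t^{2s-1}\mathbf y|||<\infty$), and $$Y^s_g:=\{\mathbf y\in Y^s:\ {\rm div}_{xt}\mathbf y=0\ \text{in }Q,\quad y_{d+1}(x,0)=-g(x)\ \text{in }\Omega\}.$$ The trace $y_{d+1}(\cdot,0)$ of a field with square-integrable (weight $t^{2s-1}$) divergence is understood in the weak sense: $\int_\Omega\eta(x,0)y_{d+1}(x,0)\,dx=-\int_Q(\eta\,{\rm div}_{xt}\mathbf y+\nabla_{xt}\eta\cdot\mathbf y)\,dxdt$ for all $\eta\in\mathcal V$. *)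

(* Defs.v *)
From HB Require Import structures.
From mathcomp Require Import all_boot all_order all_algebra.
From mathcomp Require Import all_classical all_reals all_analysis.

Set Implicit Arguments.
Unset Strict Implicit.
Unset Printing Implicit Defensive.
Import Order.TTheory GRing.Theory Num.Theory.
Import numFieldNormedType.Exports.
Local Open Scope classical_set_scope.
Local Open Scope ring_scope.

(* The sigma-algebra on R^n generated by the coordinates, as the library does *)
(* for tuples.                                                                *)
Definition rV_measure_display : measure_display.
Proof. exact: default_measure_display. Qed.

Section measurable_rV.
Context (R : realType) (n : nat).

Let coord (i : 'I_n) (v : 'rV[R]_n) : R := v ord0 i.

Let rV_set0 : g_sigma_preimage coord set0.
Proof. exact: sigma_algebra0. Qed.

Let rV_setC A : g_sigma_preimage coord A -> g_sigma_preimage coord (~` A).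
Proof. exact: sigma_algebraC. Qed.

Let rV_bigcup (F : (set 'rV[R]_n)^nat) :
  (forall i, g_sigma_preimage coord (F i)) ->
  g_sigma_preimage coord (\bigcup_i (F i)).
Proof. exact: sigma_algebra_bigcup. Qed.

HB.instance Definition _ := @isMeasurable.Build rV_measure_display
  'rV[R]_n (g_sigma_preimage coord) rV_set0 rV_setC rV_bigcup.

Lemma measurable_coord (i : 'I_n) :
  measurable_fun [set: 'rV[R]_n] (fun v : 'rV[R]_n => v ord0 i).
Proof.
move=> _ Y mY; rewrite setTI; apply: sub_sigma_algebra => /=.
rewrite -bigcup_seq/=; exists i => /=; first by rewrite mem_index_enum.
by exists Y => //; rewrite setTI.
Qed.

Lemma measurable_fun_rVP d (T : measurableType d) (f : T -> 'rV[R]_n) :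
  (forall i, measurable_fun [set: T] (fun x => f x ord0 i)) ->
  measurable_fun [set: T] f.
Proof.
move=> mf.
have : g_sigma_preimage (fun i => coord i \o f) `<=` measurable.
  apply: smallest_sub; first exact: sigma_algebra_measurable.
  move=> A; rewrite -bigcup_seq => -[i _ [B mB <-]].
  exact: mf.
rewrite g_sigma_preimage_comp => prefS _ A mA.
by apply: prefS; exists A.
Qed.

End measurable_rV.

(* d-dimensional Lebesgue measure, as the iterated product of the Lebesgue    *)
(* measure on the line: R^{n+1} is R^n x R with the last factor put first.    *)
Definition rV_cons (R : realType) (n : nat) (p : 'rV[R]_n * R) : 'rV[R]_n.+1 :=
  \row_i (if unlift ord0 i is Some j then p.1 ord0 j else p.2).

Lemma measurable_rV_cons (R : realType) (n : nat) :
  measurable_fun [set: 'rV[R]_n * R] (@rV_cons R n).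
Proof.
apply: measurable_fun_rVP => i; rewrite /rV_cons.
under eq_fun do rewrite mxE.
case: (unlift ord0 i) => [j|]; last exact: measurable_snd.
exact: (measurableT_comp (measurable_coord j) measurable_fst).
Qed.

Definition lebesgue_rV_step (R : realType) (n : nat)
    (mu : {measure set 'rV[R]_n -> \bar R}) :
    {measure set 'rV[R]_n.+1 -> \bar R}.
Proof.
refine [the {measure set 'rV[R]_n.+1 -> \bar R} of
  pushforward (mu \x lebesgue_measure)%E (@rV_cons R n)].
exact: measurable_rV_cons.
Defined.

Fixpoint lebesgue_rV (R : realType) (n : nat) :
    {measure set 'rV[R]_n -> \bar R} :=
  match n with
  | 0 => \d_(0 : 'rV[R]_0)
  | n'.+1 => lebesgue_rV_step (lebesgue_rV R n')
  end.

Lemma lebesgue_rV_box (R : realType) n (A : 'I_n -> set R) :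
  (forall i, measurable (A i)) ->
  lebesgue_rV R n [set v : 'rV[R]_n | forall i, A i (v ord0 i)] =
  (\prod_(i < n) lebesgue_measure (A i))%E.
Proof.
elim: n A => [|n IH] A mA.
  by rewrite big_ord0 /= diracE mem_set//= => i; have := ltn_ord i.
rewrite big_ord_recl /= /pushforward.
have -> : @rV_cons R n @^-1` [set v | forall i, A i (v ord0 i)] =
    [set v : 'rV[R]_n | forall i, A (lift ord0 i) (v ord0 i)] `*` A ord0.
  apply/seteqP; split => -[v t] /=.
    move=> Av; split => /= [i|].
      by move: (Av (lift ord0 i)); rewrite mxE liftK.
    by move: (Av ord0); rewrite mxE unlift_none.
  by move=> [Av At] i; rewrite mxE /=; case: unliftP => [j ->|->].
rewrite product_measure1E; first by rewrite muleC; congr (_ * _)%E; exact: IH.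
  have -> : [set v : 'rV[R]_n | forall i, A (lift ord0 i) (v ord0 i)] =
      \bigcap_(i in [set: 'I_n])
        ((fun v : 'rV[R]_n => v ord0 i) @^-1` A (lift ord0 i)).
    by apply/seteqP; split => v /= Av i; [move=> _|]; exact: Av.
  apply: fin_bigcap_measurable => // i _.
  by rewrite -[X in measurable X]setTI; exact: measurable_coord.
exact: mA.
Qed.

Section geometry.
Context (R : realType) (d : nat).
Implicit Types (Omega : set 'rV[R]_d).

Definition dotv (u v : 'rV[R]_d) : R := \sum_(i < d) u ord0 i * v ord0 i.

Definition frontier Omega : set 'rV[R]_d := closure Omega `\` Omega°.

(* Near each boundary point, Omega is the strict epigraph, in the direction   *)
(* of some unit vector n, of a Lipschitz function of the projection on the    *)
(* hyperplane orthogonal to n. Only the values of gamma on that hyperplane    *)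
(* matter; for d = 1 it is a point.                                           *)
Definition lipschitz_boundary Omega : Prop :=
  forall x0, frontier Omega x0 ->
  exists (r : R) (n : 'rV[R]_d) (gamma : 'rV[R]_d -> R),
  [/\ 0 < r, dotv n n = 1, lipschitz gamma &
    forall x, ball x0 r x ->
      (Omega x <-> gamma (x - dotv x n *: n) < dotv x n)].

Definition lipschitz_domain Omega : Prop :=
  [/\ open Omega, connected Omega, bounded_set Omega &
      lipschitz_boundary Omega].

End geometry.

(* Points (x, t) of R^{d+1}, and vectors (y_1, ..., y_{d+1}), are pairs in    *)
(* R^d x R.                                                                   *)
Section weighted_spaces.
Context (R : realType) (d : nat).
Notation E := ('rV[R]_d * R)%type.
Implicit Types (Omega : set 'rV[R]_d) (w : E -> R) (v y : E -> E) (s : R).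

Definition cylinder Omega : set E := [set z | Omega z.1 /\ 0 < z.2].

Definition lateral_boundary Omega : set E :=
  [set z | frontier Omega z.1 /\ 0 < z.2].

Definition dotxt (a b : E) : R := dotv a.1 b.1 + a.2 * b.2.

Definition lebesgue_xt :
    {measure set ('rV[R]_d * measurableTypeR R) -> \bar R} :=
  (lebesgue_rV R d \x @lebesgue_measure R)%E.

(* Measurability on Q for the sigma-algebra of lebesgue_xt: measurableTypeR   *)
(* is the Borel structure on which lebesgue_measure is defined.               *)
Definition measurable_on Omega d' (T : measurableType d') (f : E -> T) : Prop :=
  measurable_fun (cylinder Omega : set ('rV[R]_d * measurableTypeR R)) f.

(* |||.|||^2, for scalar and for vector functions                             *)
Definition wnorm2 s Omega w : \bar R :=
  (\int[lebesgue_xt]_(z in cylinder Omega)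
     (z.2 `^ (1 - 2 * s) * (w z) ^+ 2)%:E)%E.

Definition vwnorm2 s Omega v : \bar R :=
  (\int[lebesgue_xt]_(z in cylinder Omega)
     (z.2 `^ (1 - 2 * s) * dotxt (v z) (v z))%:E)%E.

Definition in_L2 Omega (g : 'rV[R]_d -> R) : Prop :=
  measurable_fun Omega g /\
  (\int[lebesgue_rV R d]_(x in Omega) (g x ^+ 2)%:E < +oo)%E.

(* C^oo on the whole of R^{d+1}: every iterated directional derivative is     *)
(* differentiable everywhere.                                                 *)
Definition smooth (f : E -> R) : Prop :=
  forall (us : seq E) (z : E),
    differentiable (foldr (fun u h => 'D_u h) f us) z.

Definition classical_grad (f : E -> R) (z : E) : E :=
  (\row_(i < d) 'D_((delta_mx ord0 i, 0) : E) f z,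
   'D_((0, 1) : E) f z).

Definition test_function Omega (f : E -> R) : Prop :=
  smooth f /\
  exists K : set E, [/\ compact K, K `<=` cylinder Omega &
    forall z, ~ K z -> f z = 0].

Definition loc_integrable Omega w : Prop :=
  measurable_on Omega w /\
  forall K : set E, K `<=` cylinder Omega -> compact K ->
    (\int[lebesgue_xt]_(z in K) `|w z|%:E < +oo)%E.

Definition is_weak_grad Omega w v : Prop :=
  [/\ loc_integrable Omega w,
      forall i : 'I_d, loc_integrable Omega (fun z => (v z).1 ord0 i),
      loc_integrable Omega (fun z => (v z).2) &
      forall f, test_function Omega f ->
        (forall i : 'I_d,
          \int[lebesgue_xt]_(z in cylinder Omega)
             (w z * (classical_grad f z).1 ord0 i) =
          - \int[lebesgue_xt]_(z in cylinder Omega)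
             ((v z).1 ord0 i * f z)) /\
        \int[lebesgue_xt]_(z in cylinder Omega)
           (w z * (classical_grad f z).2) =
        - \int[lebesgue_xt]_(z in cylinder Omega) ((v z).2 * f z)].

(* A chosen representative of the weak gradient, which is unique a.e. on Q.   *)
Definition grad Omega w : E -> E := get (is_weak_grad Omega w).

(* C^oo functions on the closure of Q with bounded support, vanishing on      *)
(* Gamma, given by a C^oo extension to R^{d+1}.                               *)
Definition smooth_vanishing Omega (f : E -> R) : Prop :=
  [/\ smooth f,
      bounded_set [set z | closure (cylinder Omega) z /\ f z != 0] &
      forall z, lateral_boundary Omega z -> f z = 0].

(* On this space |||grad w||| is a norm: w with grad w = 0 is constant on the *)
(* connected set Q, hence 0 because |||1||| = +oo. By Friedrichs' inequality  *)
(* on the bounded set Omega, the completion of smooth_vanishing for that norm *)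
(* embeds in it.                                                              *)
Definition energy_space s Omega w : Prop :=
  [/\ exists v, is_weak_grad Omega w v,
      (wnorm2 s Omega w < +oo)%E &
      (vwnorm2 s Omega (grad Omega w) < +oo)%E].

(* The space V: the closure of smooth_vanishing in the norm |||grad w|||.     *)
Definition in_V s Omega w : Prop :=
  energy_space s Omega w /\
  forall e : R, 0 < e ->
  exists2 f, smooth_vanishing Omega f &
    (vwnorm2 s Omega (fun z => grad Omega w z - classical_grad f z)%R
       < e%:E)%E.

(* The trace on Omega x {0} is the extension of f |-> f(., 0) from smooth     *)
(* functions to V, continuous from the norm |||grad w||| to L^2(Omega).       *)
Definition is_trace s Omega w (w0 : 'rV[R]_d -> R) : Prop :=
  in_L2 Omega w0 /\
  forall e : R, 0 < e ->
  exists f, [/\ smooth_vanishing Omega f,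
    (vwnorm2 s Omega (fun z => grad Omega w z - classical_grad f z)%R
       < e%:E)%E &
    (\int[lebesgue_rV R d]_(x in Omega) ((w0 x - f (x, 0)) ^+ 2)%:E
       < e%:E)%E].

Definition trace s Omega w : 'rV[R]_d -> R := get (is_trace s Omega w).

Definition is_weak_solution s Omega (g : 'rV[R]_d -> R) w : Prop :=
  in_V s Omega w /\
  forall eta, in_V s Omega eta ->
    \int[lebesgue_xt]_(z in cylinder Omega)
       (z.2 `^ (1 - 2 * s) * dotxt (grad Omega w z) (grad Omega eta z))
    - \int[lebesgue_rV R d]_(x in Omega) (g x * trace s Omega eta x) = 0.

Definition flux s Omega w : E -> E :=
  fun z => z.2 `^ (1 - 2 * s) *: grad Omega w z.

Definition scaled s y : E -> E := fun z => z.2 `^ (2 * s - 1) *: y z.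

Definition in_Y s Omega y : Prop :=
  measurable_on Omega y /\ (vwnorm2 s Omega (scaled s y) < +oo)%E.

Definition is_weak_div Omega y (h : E -> R) : Prop :=
  forall f, test_function Omega f ->
    \int[lebesgue_xt]_(z in cylinder Omega) dotxt (y z) (classical_grad f z) =
    - \int[lebesgue_xt]_(z in cylinder Omega) (h z * f z).

(* y_{d+1}(., 0) = b for a field y with weak divergence h                     *)
Definition is_normal_trace s Omega y (h : E -> R) (b : 'rV[R]_d -> R) : Prop :=
  forall eta, in_V s Omega eta ->
    \int[lebesgue_rV R d]_(x in Omega) (trace s Omega eta x * b x) =
    - \int[lebesgue_xt]_(z in cylinder Omega)
        (eta z * h z + dotxt (grad Omega eta z) (y z)).

Definition in_Yg s Omega (g : 'rV[R]_d -> R) y : Prop :=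
  [/\ in_Y s Omega y, is_weak_div Omega y (cst 0) &
      is_normal_trace s Omega y (cst 0) (fun x => - g x)].

End weighted_spaces.

(* Main.v *)
Require Import Defs.
From HB Require Import structures.
From mathcomp Require Import all_boot all_order all_algebra.
From mathcomp Require Import all_classical all_reals all_analysis.
From mathcomp Require Import measurable_realfun ring lra.
Set Implicit Arguments.
Unset Strict Implicit.
Unset Printing Implicit Defensive.
Import Order.TTheory GRing.Theory Num.Theory.
Import numFieldNormedType.Exports.
Local Open Scope classical_set_scope.
Local Open Scope ring_scope.

(* Write G, H for the weak gradients of wt and w, Y = t^(2s-1) y, and (a, b) for
   the inner product with weight t^(1-2s). Testing the weak equation for w and
   the normal trace condition for y with the same function u gives
   (grad u, Y) = (grad u, H); the traces of u cancel, so nothing about the trace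
   operator is needed. With u = wt and u = w this is (G, Y) = (G, H) and
   (H, Y) = (H, H), hence (G - H, Y - H) = 0, and the identity is Pythagoras'
   theorem for G - Y = (G - H) - (Y - H).
   Since the gradient is a chosen representative, grad (wt - w) = G - H has to
   be proved almost everywhere, by uniqueness of weak gradients: a locally
   integrable function orthogonal to all test functions has zero integral on
   boxes (approximate their indicators by smooth bumps), hence on all measurable
   subsets of a box, and so vanishes. *)

(** * Smooth bump functions *)

Section flat.
Context {R : realType}.

(** The functions x^(-n) exp(-1/x), extended by 0 to x <= 0. Case n = 0 is the classical smooth,
    non-analytic function; larger n are the terms that its derivatives produce. *)
Definition flat (n : nat) (x : R) : R :=
  if 0 < x then x^-1 ^+ n * expR (- x^-1) else 0.

(** Raise x/n <= 1 + x/n <= exp(x/n) to the n-th power. *)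
Lemma exprn_le_expR (n : nat) (x : R) : 0 <= x ->
  x ^+ n <= n%:R ^+ n * expR x.
Proof.
case: n => [|n] x0; first by rewrite !expr0 mul1r -expR0 ler_expR.
have n0 : 0 < n.+1%:R :> R by rewrite ltr0n.
rewrite -{2}(divfK (lt0r_neq0 n0) x) expRM_natr -exprMn.
apply: lerXn2r; rewrite ?nnegrE ?mulr_ge0 ?expR_ge0// mulrC -ler_pdivrMr//.
by rewrite (le_trans _ (expR_ge1Dx _))// lerDr.
Qed.

(** Two powers of x are split off and [exprn_le_expR] is applied to 1/x with exponent n + 2. A
    quadratic bound is what differentiability at 0 calls for. *)
Lemma flat_le (n : nat) (x : R) : `|flat n x| <= n.+2%:R ^+ n.+2 * x ^+ 2.
Proof.
rewrite /flat; case: ifPn => [x0|_]; last first.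
  by rewrite normr0 mulr_ge0// ?sqr_ge0// exprn_ge0.
have xV0 : 0 <= x^-1 by rewrite invr_ge0 ltW.
rewrite ger0_norm ?mulr_ge0 ?expR_ge0 ?exprn_ge0//.
have h : x^-1 ^+ n.+2 * expR (- x^-1) <= n.+2%:R ^+ n.+2.
  by rewrite expRN ler_pdivrMr ?expR_gt0// exprn_le_expR.
have -> : x^-1 ^+ n * expR (- x^-1) = x^-1 ^+ n.+2 * expR (- x^-1) * x ^+ 2.
  by rewrite -addn2 exprD; field; exact: lt0r_neq0.
by rewrite ler_wpM2r// sqr_ge0.
Qed.

Lemma flat_is_derive (n : nat) (x : R) :
  is_derive x 1 (flat n) (flat n.+2 x - n%:R * flat n.+1 x).
Proof.
have [x0|x0|->] := ltgtP x 0.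
- rewrite /flat ltNge (ltW x0)/= mulr0 subr0.
  apply: (@near_eq_is_derive _ _ _ (cst 0)); near=> z => /=.
  rewrite ltNge (_ : z <= 0)//.
  by rewrite ltW//; near: z; exact: lt_nbhsl.
- rewrite /flat x0.
  apply: (@near_eq_is_derive _ _ _
    ((fun y : R => y^-1) ^+ n * (expR \o (- (fun y : R => y^-1))))).
    near=> z => /=; rewrite exprfctE (_ : 0 < z)//.
    by near: z; exact: lt_nbhsr.
  have dV : is_derive x 1 (fun y : R => y^-1) (- x ^- 2).
    apply: DeriveDef; first exact: derivableV (lt0r_neq0 x0) _.
    by rewrite deriveV ?lt0r_neq0// derive_id scaler1.
  have dE := @is_deriveM _ _ _ _ x 1 _ _ (is_deriveX n dV)
    (is_derive1_comp (is_derive_expR _) (is_deriveN dV)).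
  apply: is_derive_eq dE _.
  rewrite !fctE /GRing.scale/= !exprVn.
  case: n => [|n] /=; rewrite ?exprS; field;
    rewrite ?expf_neq0 ?lt0r_neq0//.
- have -> : flat n.+2 0 - n%:R * flat n.+1 0 = 0 :> R.
    by rewrite /flat ltxx mulr0 subr0.
  set C : R := n.+2%:R ^+ n.+2.
  have C0 : 0 < C by rewrite exprn_gt0// ltr0n.
  (* By [flat_le] the difference quotient at 0 is at most C |h|. *)
  have H : h^-1 *: (flat n (h *: 1 + 0) - flat n 0) @[h --> (0:R)^'] --> (0:R).
    apply/cvgrPdist_le => /= e e0; near=> h.
    have h0 : h != 0 by near: h; exact: nbhs_dnbhs_neq.
    rewrite sub0r normrN addr0 {2}/flat ltxx subr0 normrM normrV ?unitfE//.
    rewrite [h%:A]mulr1 ler_pdivrMl ?normr_gt0// (le_trans (flat_le _ _))//.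
    rewrite -/C -[h ^+ 2]ger0_norm ?sqr_ge0// normrX expr2 mulrCA.
    rewrite ler_wpM2l// mulrC -ler_pdivlMr//.
    by near: h; apply: dnbhs0_le; rewrite divr_gt0.
  by apply: DeriveDef; [apply/cvg_ex; exists 0|apply: cvg_lim].
Unshelve. all: by end_near.
Qed.
End flat.

(** * A class of smooth functions closed under differentiation *)

Section elementary.
Context {R : realType} {V : normedModType R}.
Implicit Types f g : V -> R.

(* A subalgebra of smooth functions whose definition makes its stability under
   directional derivatives immediate; it contains the bumps below. *)
Inductive elementary : (V -> R) -> Prop :=
| elementary_cst c : elementary (cst c)
| elementary_flat n g of (forall z, differentiable g z) &
    (forall u, exists c, 'D_u g = cst c) : elementary (flat n \o g)
| elementaryD f g of elementary f & elementary g : elementary (f + g)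
| elementaryM f g of elementary f & elementary g : elementary (f * g).

Lemma flat_differentiable n (x : R) : differentiable (flat n) x.
Proof. by apply/derivable1_diffP; have [] := flat_is_derive n x. Qed.

Lemma elementary_differentiable f z : elementary f -> differentiable f z.
Proof.
elim=> [c|n g dg _|f1 f2 _ d1 _ d2|f1 f2 _ d1 _ d2].
- exact: differentiable_cst.
- by apply: differentiable_comp => //; exact: flat_differentiable.
- exact: differentiableD.
- exact: differentiableM.
Qed.

(** In the generator [flat n \o g] the derivative of g along u is a constant, so the chain rule and
    [flat_is_derive] give a combination of generators with constant coefficients; sums and products
    follow from Leibniz' rule. *)
Lemma elementary_derive f u : elementary f -> elementary ('D_u f).
Proof.
elim=> [c|n g dg cg|f1 f2 e1 d1 e2 d2|f1 f2 e1 d1 e2 d2].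
- rewrite (_ : 'D_u _ = cst 0); first exact: elementary_cst.
  by apply/funext => z; rewrite derive_cst.
- have [c Dc] := cg u.
  rewrite (_ : 'D_u _ =
    (flat n.+2 \o g + cst (- n%:R) * (flat n.+1 \o g)) * cst c).
    apply: elementaryM; last exact: elementary_cst.
    apply: elementaryD; first exact: elementary_flat.
    apply: elementaryM; first exact: elementary_cst.
    exact: elementary_flat.
  apply/funext => z; rewrite deriveE; last first.
    by apply: differentiable_comp => //; exact: flat_differentiable.
  rewrite diff_comp//; last exact: flat_differentiable.
  have dgc : 'd g z u = c 
    by rewrite -deriveE//; have /= -> := congr1 (@^~ z) Dc.
  have [dF F'] := flat_is_derive n (g z).
  rewrite /= dgc deriv1E// derive1E F' /GRing.scale/= !fctE.
  by rewrite mulNr mulrC.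
- rewrite (_ : 'D_u _ = 'D_u f1 + 'D_u f2); first exact: elementaryD.
  apply/funext => z; rewrite deriveD//;
    exact/diff_derivable/elementary_differentiable.
- rewrite (_ : 'D_u _ = f1 * 'D_u f2 + f2 * 'D_u f1).
    by apply: elementaryD; exact: elementaryM.
  apply/funext => z; rewrite deriveM//;
    exact/diff_derivable/elementary_differentiable.
Qed.

Lemma elementary_prod (I : Type) (r : seq I) (F : I -> V -> R) :
  (forall i, elementary (F i)) -> elementary (\prod_(i <- r) F i).
Proof.
move=> eF; elim/big_ind : _ => // [|f g]; first exact: elementary_cst.
exact: elementaryM.
Qed.

End elementary.

(** * Coordinates of R^(d+1), boxes and their bumps *)

Section coordinates.
Context {R : realType} {d : nat}.
Notation E := ('rV[R]_d * R)%type.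

(* The coordinates of R^(d+1); None is the last one, t. *)
Definition coord (i : option 'I_d) (z : E) : R :=
  if i is Some j then z.1 ord0 j else z.2.

Fact coord_is_linear i : linear (coord i : E -> R^o).
Proof. by case: i => [j|] k u v //=; rewrite !mxE. Qed.

HB.instance Definition _ i :=
  GRing.isLinear.Build R E R^o _ (coord i) (coord_is_linear i).

Lemma coord_continuous_xt i : continuous (coord i).
Proof.
case: i => [j|] z /=; last exact: cvg_snd.
by apply: (@continuous_comp _ _ _ fst (fun v : 'rV[R]_d => v ord0 j));
  [exact: cvg_fst|exact: coord_continuous].
Qed.

Lemma coord_differentiable i z : differentiable (coord i) z.
Proof. exact/linear_differentiable/coord_continuous_xt. Qed.

Lemma derive_coord i u z : 'D_u (coord i) z = coord i u.
Proof.
rewrite deriveE ?diff_lin//; last exact: coord_differentiable.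
exact: coord_continuous_xt.
Qed.

Lemma elementary_smooth (f : E -> R) : elementary f -> smooth f.
Proof.
move=> ef us z; apply: elementary_differentiable.
by elim: us => //= u us; exact: elementary_derive.
Qed.

Definition box (a b : option 'I_d -> R) : set E :=
  [set z | forall i, a i < coord i z < b i].

Definition cbox (a b : option 'I_d -> R) : set E :=
  [set z | forall i, a i <= coord i z <= b i].

Lemma subset_box_cbox a b : box a b `<=` cbox a b.
Proof. by move=> z zab i; have /andP[/ltW -> /ltW ->] := zab i. Qed.

Lemma compact_cbox a b : compact (cbox a b).
Proof.
rewrite (_ : cbox a b =
    [set v : 'rV[R]_d | forall j,
      `[a (Some j), b (Some j)]%classic (v ord0 j)] `*`
    `[a None, b None]%classic).
  apply: compact_setX; last exact: segment_compact.
  apply: (@rV_compact R d (fun j => `[a (Some j), b (Some j)]%classic)) => j.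
  exact: segment_compact.
apply/seteqP; split => [z zab|z [zab1 zab2] [j|]].
- split => [j|]; first by have := zab (Some j); rewrite /= in_itv.
  by have := zab None; rewrite /= in_itv.
- by have := zab1 j; rewrite /= in_itv.
- by move: zab2; rewrite /= in_itv.
Qed.

(** Each coordinate contributes one factor per face of the box, vanishing beyond that face. Scaling
    by N + 1 > 0 steepens the factors, so that the bumps tend to the indicator of the open box. *)
Definition bump (a b : option 'I_d -> R) (N : nat) : E -> R :=
  \prod_(i : option 'I_d)
    ((flat 0 \o (N.+1%:R *: (coord i - cst (a i)) : E -> R)) *
     (flat 0 \o (N.+1%:R *: (cst (b i) - coord i) : E -> R))).

Lemma smooth_bump a b N : smooth (bump a b N).
Proof.
apply: elementary_smooth; apply: elementary_prod => i.
have dc z : differentiable (coord i) z by exact: coord_differentiable.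
have dk k z : differentiable (cst k : E -> R) z by exact: differentiable_cst.
have vc z u : derivable (coord i) z u by exact: diff_derivable.
have vk k z u : derivable (cst k : E -> R) z u by exact: derivable_cst.
refine (elementaryM (elementary_flat _ _ _) (elementary_flat _ _ _)).
- by move=> z; apply: differentiableZ; apply: differentiableB.
- move=> u; exists (N.+1%:R * coord i u); apply/funext => z.
  rewrite deriveZ; last exact: derivableB.
  by rewrite deriveB// derive_cst subr0 derive_coord.
- by move=> z; apply: differentiableZ; apply: differentiableB.
- move=> u; exists (N.+1%:R * - coord i u); apply/funext => z.
  rewrite deriveZ; last exact: derivableB.
  by rewrite deriveB// derive_cst sub0r derive_coord.
Qed.

Lemma flat0_ge0 (x : R) : 0 <= flat 0 x.
Proof. by rewrite /flat; case: ifP => // _; rewrite mulr_ge0// expR_ge0. Qed.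

Lemma flat0_le1 (x : R) : flat 0 x <= 1.
Proof.
rewrite /flat; case: ifP => // x0.
by rewrite expr0 mul1r -expR0 ler_expR oppr_le0 invr_ge0 ltW.
Qed.

Lemma bumpE a b N z : bump a b N z = \prod_(i : option 'I_d)
  (flat 0 (N.+1%:R * (coord i z - a i)) * flat 0 (N.+1%:R * (b i - coord i z))).
Proof. by rewrite /bump fct_prodE. Qed.

Lemma bump_ge0 a b N z : 0 <= bump a b N z.
Proof. by rewrite bumpE prodr_ge0// => i _; rewrite mulr_ge0// flat0_ge0. Qed.

Lemma bump_le1 a b N z : bump a b N z <= 1.
Proof.
rewrite bumpE prodr_ile1// => i _.
by rewrite mulr_ge0 ?flat0_ge0// mulr_ile1 ?flat0_ge0// flat0_le1.
Qed.

Lemma bump_out a b N z : ~ box a b z -> bump a b N z = 0.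
Proof.
move=> /existsNP[i /negP]; rewrite negb_and -!leNgt bumpE (bigD1 i)//= => h.
rewrite [X in X * _](_ : _ = 0) ?mul0r//.
case/orP: h => h; rewrite /flat.
  by rewrite ltNge pmulr_rle0// subr_le0 h/= mul0r.
by rewrite [X in _ * (if X then _ else _)]ltNge pmulr_rle0// subr_le0 h/= mulr0.
Qed.

Lemma flat0_cvg1 (c : R) : 0 < c ->
  flat 0 (N.+1%:R * c) @[N --> \oo] --> (1 : R).
Proof.
move=> c0.
(* For c > 0 the value is exp(-1/((N+1)c)), whose exponent tends to 0. *)
rewrite (_ : (fun N => _) = fun N => expR (- (N.+1%:R^-1 * c^-1))).
  rewrite -[X in _ --> X]expR0 -oppr0 -(mul0r c^-1).
  apply: continuous_cvg; first exact: continuous_expR.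
  by apply: cvgN; apply: cvgMl; exact: cvg_harmonic.
apply/funext => N.
by rewrite /flat pmulr_rgt0 ?ltr0n// c0 expr0 mul1r invfM.
Qed.

Lemma bump_cvg1 a b z : box a b z -> bump a b N z @[N --> \oo] --> (1 : R).
Proof.
move=> zab.
under eq_fun do rewrite bumpE.
elim: (index_enum _) => [|i r IH].
  by under eq_fun do rewrite big_nil; exact: cvg_cst.
under eq_fun do rewrite big_cons.
have /andP[ai bi] := zab i.
have ca : flat 0 (N.+1%:R * (coord i z - a i)) @[N --> \oo] --> (1 : R).
  by apply: flat0_cvg1; rewrite subr_gt0.
have cb : flat 0 (N.+1%:R * (b i - coord i z)) @[N --> \oo] --> (1 : R).
  by apply: flat0_cvg1; rewrite subr_gt0.
by have {ca cb IH} := cvgM (cvgM ca cb) IH; rewrite !mulr1; apply.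
Qed.


End coordinates.

(** * Boxes and the Borel sets of R^(d+1) *)

Section boxes.
Context {R : realType} {d : nat}.
Notation E := ('rV[R]_d * R)%type.
Notation mE := ('rV[R]_d * measurableTypeR R)%type.

Lemma measurable_coord_xt i :
  measurable_fun [set: mE] (coord i : mE -> measurableTypeR R).
Proof.
case: i => [j|]; last exact: measurable_snd.
exact: measurableT_comp (measurable_coord j) measurable_fst.
Qed.

Lemma measurable_box (a b : option 'I_d -> R) : measurable (box a b : set mE).
Proof.
rewrite (_ : box a b = \bigcap_(i in [set: option 'I_d])
    ((coord i : mE -> measurableTypeR R) @^-1` `]a i, b i[%classic)).
  apply: fin_bigcap_measurable => // i _; rewrite -[X in measurable X]setTI.
  by apply: measurable_coord_xt => //; exact: measurable_itv.
apply/seteqP; split => z /= zab i.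
  by move=> _; have := zab i; rewrite /= in_itv.
by have := zab i I; rewrite /= in_itv.
Qed.

Notation rational_corners :=
  ({ffun option 'I_d -> rat} * {ffun option 'I_d -> rat})%type.

Definition rational_box (p : rational_corners) :=
  box (fun i => ratr (p.1 i) : R) (fun i => ratr (p.2 i)).

(** Rational corners make the union countable. The closed boxes are required to lie in U so that
    bumps on the open ones have compact support in U. *)
Lemma open_bigcup_box (U : set E) : open U ->
  U = \bigcup_(p in [set p : rational_corners |
    cbox (fun i => ratr (p.1 i) : R) (fun i => ratr (p.2 i)) `<=` U])
    rational_box p.
Proof.
move=> oU; apply/seteqP; split => [z Uz|z [p /= + zp]]; last first.
  by apply; exact: subset_box_cbox.
have [e /= e0 zeU] : nbhs_ball z U by apply/nbhs_ballP; exact: open_nbhs_nbhs.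
(* Corners within e of z in every coordinate keep the closed box inside the ball of radius e, which
   is a cube for the max norm. *)
have /choice[a ha] i : exists q : rat, ratr q \in `]coord i z - e, coord i z[.
  by apply: rat_in_itvoo; rewrite ltrBlDr ltrDl.
have /choice[b hb] i : exists q : rat, ratr q \in `]coord i z, coord i z + e[.
  by apply: rat_in_itvoo; rewrite ltrDl.
exists (finfun a, finfun b) => /= [y yab|i]; last first.
  rewrite !ffunE; move: (ha i) (hb i).
  by rewrite !in_itv/= => /andP[_ ->] /andP[].
have near_y i : `|coord i z - coord i y| < e.
  move: (yab i) (ha i) (hb i); rewrite !ffunE !in_itv/=.
  move=> /andP[h1 h2] /andP[h3 h4] /andP[h5 h6].
  rewrite ltr_norml; lra.
apply: zeU; split => [|]; last exact: (near_y None).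
by split => // j k; rewrite (ord1 j); exact: (near_y (Some k)).
Qed.

(** The sigma-algebra of [mE] is generated by coordinates, not by the topology; countable unions of
    boxes link the two. *)
Lemma measurable_open (U : set E) : open U -> measurable (U : set mE).
Proof.
move=> /open_bigcup_box ->; rewrite bigcup_mkcond.
apply: countable_bigcupT_measurable => // p.
by case: ifP => // _; exact: measurable_box.
Qed.

Lemma measurable_continuous (f : E -> R) : continuous f ->
  measurable_fun [set: mE] (f : mE -> R).
Proof.
move=> cf.
apply: (measurability _ (RGenOpens.measurableE R)) => _ [_ [x [y ->]] <-].
rewrite setTI; apply: measurable_open.
by apply: open_comp => //; exact: interval_open.
Qed.

Lemma measurable_compact (K : set E) : compact K -> measurable (K : set mE).
Proof.
move=> /compact_closed cK.
rewrite -[X in measurable X]setCK; apply: measurableC.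
apply: measurable_open; rewrite openC; apply: cK; exact: norm_hausdorff.
Qed.

Definition boxes : set (set mE) := [set B | exists a b, B = box a b].

(** Exhibits the boxes as a generating family for Dynkin's theorem. *)
Lemma measurable_boxesE : @measurable _ mE = <<s boxes >>.
Proof.
apply/seteqP; split; last first.
  apply: smallest_sub; first exact: sigma_algebra_measurable.
  by move=> _ [a [b ->]]; exact: measurable_box.
have mO (U : set E) : open U -> <<s boxes >> U.
  move=> /open_bigcup_box ->; rewrite bigcup_mkcond.
  apply: (@countable_bigcupT_measurable _ (g_sigma_algebraType boxes)) => // p.
  case: ifP => // _; apply: sub_sigma_algebra.
  by exists (fun i => ratr (p.1 i)), (fun i => ratr (p.2 i)).
have mc i : measurable_fun [set: g_sigma_algebraType boxes]
    (coord i : g_sigma_algebraType boxes -> R).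
  apply: (measurability _ (RGenOpens.measurableE R)) => _ [_ [x [y ->]] <-].
  rewrite setTI; apply: mO.
  apply: open_comp; last exact: interval_open.
  by move=> z _; exact: coord_continuous_xt.
(* Measurability of the identity between the two structures is exactly the inclusion of
   sigma-algebras, and it can be tested on coordinates. *)
have mid : measurable_fun [set: g_sigma_algebraType boxes]
    (id : g_sigma_algebraType boxes -> mE).
  apply/measurable_fun_pairP; split; last exact: (mc None).
  by apply: measurable_fun_rVP => i; exact: (mc (Some i)).
by move=> A mA; have := mid measurableT A mA; rewrite setTI.
Qed.

Lemma box_setI (a b a' b' : option 'I_d -> R) : box a b `&` box a' b' =
  box (fun i => Num.max (a i) (a' i)) (fun i => Num.min (b i) (b' i)).
Proof.
apply/seteqP; split => z /=.
  move=> [zab zab'] i; have /andP[h1 h2] := zab i; have /andP[h3 h4] := zab' i.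
  by rewrite gt_max lt_min h1 h2 h3 h4.
by move=> h; split => i; have := h i; rewrite gt_max lt_min
  => /andP[/andP[h1 h2] /andP[h3 h4]]; apply/andP.
Qed.

Lemma setI_closed_boxes : setI_closed boxes.
Proof.
by move=> _ _ [a [b ->]] [a' [b' ->]]; rewrite box_setI; do 2!eexists.
Qed.

End boxes.

(** * Functions orthogonal to all test functions *)

Section fundamental_lemma.
Context {R : realType} {d : nat}.
Notation E := ('rV[R]_d * R)%type.
Notation mE := ('rV[R]_d * measurableTypeR R)%type.
Notation mu := (@lebesgue_xt R d).
Context (Omega : set 'rV[R]_d) (openOmega : open Omega).
Let Q : set mE := cylinder Omega.

Lemma open_cylinder : open (cylinder Omega).
Proof.
rewrite (_ : cylinder Omega =
  (fst : E -> _) @^-1` Omega `&` (snd : E -> _) @^-1` [set t | 0 < t])//.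
apply: openI; apply: open_comp.
- by move=> z _; exact: cvg_fst.
- exact: openOmega.
- by move=> z _; exact: cvg_snd.
- exact: open_gt.
Qed.

Lemma measurable_cylinder : measurable Q.
Proof. by apply: measurable_open; exact: open_cylinder. Qed.

Lemma loc_integrable_compact (u : E -> R) (K : set E) :
  loc_integrable Omega u -> K `<=` cylinder Omega -> compact K ->
  mu.-integrable (K : set mE) (EFin \o u).
Proof.
move=> [um iu] KQ cK; have mK := measurable_compact cK.
apply/integrableP; split; last exact: iu.
by apply/measurable_EFinP; apply: measurable_funS um => //;
  exact: measurable_cylinder.
Qed.

Lemma test_function_bump (a b : option 'I_d -> R) N :
  cbox a b `<=` cylinder Omega -> test_function Omega (bump a b N).
Proof.
move=> abQ; split; first exact: smooth_bump.
exists (cbox a b); split => //; first exact: compact_cbox.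
by move=> z /(contra_not (@subset_box_cbox _ _ _ _ z)); exact: bump_out.
Qed.

Section orthogonal.
Context (u : E -> R) (loc_u : loc_integrable Omega u).
Context (u_test : forall f, test_function Omega f ->
  \int[mu]_(z in Q) (u z * f z) = 0).

Lemma integrable_box (a b : option 'I_d -> R) : cbox a b `<=` cylinder Omega ->
  mu.-integrable (box a b : set mE) (EFin \o u).
Proof.
move=> abQ; apply: (@integrableS _ _ _ _ (cbox a b : set mE)).
- by apply: measurable_compact; exact: compact_cbox.
- exact: measurable_box.
- exact: subset_box_cbox.
- by apply: loc_integrable_compact => //; exact: compact_cbox.
Qed.

(** The bumps are test functions bounded by 1 and tending to 1 on the open box; dominated
    convergence with bound |u| passes to the limit. *)
Lemma integral_box_eq0 (a b : option 'I_d -> R) :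
  cbox a b `<=` cylinder Omega ->
  (\int[mu]_(z in (box a b : set mE)) (u z)%:E = 0)%E.
Proof.
move=> abQ; have iu := integrable_box abQ.
have mB : measurable (box a b : set mE) by exact: measurable_box.
have mubox : measurable_fun (box a b : set mE) u.
  by have /integrableP[/measurable_EFinP] := iu.
have mbump N : measurable_fun (box a b : set mE) (bump a b N : mE -> R).
  apply: measurable_funTS; apply: measurable_continuous => z.
  exact/differentiable_continuous/(smooth_bump a b N [::]).
have mf N :
    measurable_fun (box a b : set mE) (fun z => (u z * bump a b N z)%:E).
  by apply/measurable_EFinP; exact: measurable_funM.
have le_u N z : `|u z * bump a b N z| <= `|u z|.
  rewrite normrM -[leRHS]mulr1 ler_wpM2l// ger0_norm ?bump_ge0//.
  exact: bump_le1.
have iub N :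
    mu.-integrable (box a b : set mE) (fun z => (u z * bump a b N z)%:E).
  apply: le_integrable iu => // z _ /=; rewrite lee_fin; exact: le_u.
have int0 N :
    (\int[mu]_(z in (box a b : set mE)) (u z * bump a b N z)%:E = 0)%E.
  rewrite -[LHS]fineK; last exact: integrable_fin_num.
  congr EFin; rewrite -(u_test (test_function_bump N abQ)) /Rintegral.
  congr fine.
  (* The bump vanishes off the box, so integrating over the box or over Q is the same. *)
  rewrite -[X in (\int[_]_(_ in X) _)%E](@setIidr _ Q (box a b)); last first.
    by move=> z /subset_box_cbox /abQ.
  rewrite integral_mkcondr; apply: eq_integral => z _; rewrite patchE.
  case: ifPn => // /negP zab.
  by rewrite bump_out ?mulr0// => zab'; apply: zab; rewrite inE.
have [//|||_ _ cvgI] := @dominated_convergence _ mE R mu _ mB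
  (fun N z => (u z * bump a b N z)%:E) (EFin \o u) (fun z => `|u z|%:E) mf
  (measurable_int mu iu).
- apply: aeW => z zab.
  apply: cvg_EFin; first exact: nearW.
  rewrite -[X in _ --> X]mulr1; apply: cvgMr; exact: bump_cvg1.
- by have := integrable_abse iu.
- by apply: aeW => z N _; rewrite lee_fin.
have := cvg_lim (@ereal_hausdorff R) cvgI.
rewrite (_ : [sequence _]_n = cst 0%E); last first.
  by apply/funext => N; exact: int0.
by rewrite lim_cst => [<-//|]; exact: ereal_hausdorff.
Qed.

(** The sets A for which u has zero integral over the part of A in the box form a Dynkin system
    containing the boxes, which are stable under intersection. Hence every measurable A qualifies,
    and u vanishes a.e. on the box. *)
Lemma ae_eq0_box (a b : option 'I_d -> R) : cbox a b `<=` cylinder Omega ->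
  ae_eq mu (box a b : set mE) (EFin \o u) (cst 0%E).
Proof.
move=> abQ; have iu := integrable_box abQ.
have mB : measurable (box a b : set mE) by exact: measurable_box.
have iuS (A : set mE) : measurable A ->
    mu.-integrable (A `&` box a b) (EFin \o u).
  move=> mA; apply: integrableS iu => //; first exact: measurableI.
suff H (A : set mE) : measurable A ->
  (\int[mu]_(z in A `&` box a b) (u z)%:E = 0)%E.
  apply: integral_ae_eq => // A AB mA; rewrite integral0.
  by rewrite -[A](setIidl AB); exact: H.
rewrite measurable_boxesE.
move: A; apply: (@dynkin_induction _ mE boxes
  (fun A => \int[mu]_(z in A `&` box a b) (u z)%:E = 0)%E
  measurable_boxesE setI_closed_boxes).
- by rewrite setTI; exact: integral_box_eq0.
- move=> _ [a' [b' ->]]; rewrite box_setI; apply: integral_box_eq0.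
  apply: subset_trans abQ => z zab i; have := zab i.
  by rewrite ge_max le_min => /andP[/andP[_ ->] /andP[_ ->]].
- move=> A mA A0; rewrite -[RHS](integral_box_eq0 abQ).
  have {2}-> : (box a b : set mE) = (A `&` box a b) `|` (~` A `&` box a b).
    by rewrite -setIUl setUv setTI.
  rewrite integral_setU.
  - by rewrite [X in (X + _)%E]A0 add0e.
  - exact: measurableI.
  - by apply: measurableI => //; exact: measurableC.
  - by rewrite -setIUl setUv setTI; have /integrableP[] := iu.
  - by rewrite disj_set2E setIACA setICr set0I.
- move=> F mF tF F0.
  rewrite setI_bigcupl integral_bigcup//.
  + by rewrite eseries0.
  + exact: trivIset_setIr.
  + by move=> k; exact: measurableI.
  + by rewrite -setI_bigcupl; apply: iuS; exact: bigcupT_measurable.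
Qed.

(* du Bois-Reymond's lemma *)
Lemma ae_eq0_cylinder : {ae mu, forall z, Q z -> u z = 0}.
Proof.
pose J := ({ffun option 'I_d -> rat} * {ffun option 'I_d -> rat})%type.
pose a (p : J) i : R := ratr (p.1 i); pose b (p : J) i : R := ratr (p.2 i).
(* [N p] is the exceptional set of the rational box p, empty when the closed box leaves Q; these
   sets are then enumerated through [unpickle]. *)
pose N (p : J) := [set z | cbox (a p) (b p) `<=` cylinder Omega /\
  box (a p) (b p) z /\ u z != 0].
have negN p : mu.-negligible (N p).
  have [abQ|nabQ] := pselect (cbox (a p) (b p) `<=` cylinder Omega).
    have := ae_eq0_box abQ; apply: negligibleS => z [_ [zab uz0]] /= h.
    by move: uz0; have [->] := h zab; rewrite eqxx.
  rewrite (_ : N p = set0); first exact: negligible_set0.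
  by rewrite -subset0 => z [].
pose F n := if unpickle n is Some p then N p else set0.
have /negligibleS : mu.-negligible (\bigcup_n F n).
  apply: negligible_bigcup => n; rewrite /F.
  by case: unpickle => //; exact: negligible_set0.
apply => z /= /not_implyP[Qz /eqP uz0].
have [p /= pQ zp] : (\bigcup_(p in [set p : J |
    cbox (a p) (b p) `<=` cylinder Omega]) rational_box p) z.
  by rewrite -(open_bigcup_box open_cylinder).
by exists (pickle p) => //; rewrite /F pickleK.
Qed.

End orthogonal.
End fundamental_lemma.

(** * Weak gradients *)

Section weak_gradient.
Context {R : realType} {d : nat}.
Notation E := ('rV[R]_d * R)%type.
Notation mE := ('rV[R]_d * measurableTypeR R)%type.
Notation mu := (@lebesgue_xt R d).
Context (Omega : set 'rV[R]_d) (openOmega : open Omega).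
Let Q : set mE := cylinder Omega.
Implicit Types (u w f : E -> R) (v : E -> E).

Let mQ : measurable Q := measurable_cylinder openOmega.

Lemma loc_integrableB u w : loc_integrable Omega u -> loc_integrable Omega w ->
  loc_integrable Omega (fun z => u z - w z).
Proof.
move=> lu lw; split; first by apply: measurable_funB; [case: lu|case: lw].
move=> K KQ cK; have mK : measurable (K : set mE) by exact: measurable_compact.
have iu := loc_integrable_compact openOmega lu KQ cK.
have iw := loc_integrable_compact openOmega lw KQ cK.
by have /integrableP[_] := integrableB mK iu iw.
Qed.

(** On K, u is integrable and the continuous f is bounded; elsewhere the product is zero. *)
Lemma integrableM_compact_supp u f (K : set E) : loc_integrable Omega u ->
  continuous f -> compact K -> K `<=` cylinder Omega ->
  (forall z, ~ K z -> f z = 0) ->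
  mu.-integrable Q (fun z => (u z * f z)%:E).
Proof.
move=> lu cf cK KQ f0.
have mK : measurable (K : set mE) by exact: measurable_compact.
have : mu.-integrable (K : set mE) ((EFin \o u) \* (EFin \o f))%E.
  apply: integrableMl => //.
  - exact: (loc_integrable_compact openOmega lu KQ cK).
  - by apply: measurable_funTS; exact: measurable_continuous.
  - have /compact_bounded[M [Mreal MK]] : compact (f @` K).
      apply: continuous_compact => //; exact: continuous_subspaceT.
    exists M; split => // x Mx z Kz; exact: (MK x Mx (f z)).
move=> /(integrable_mkcond _ mK) /(integrableS measurableT mQ (@subsetT _ _)).
apply: eq_integrable => // z _; rewrite patchE /=.
case: ifPn => // /negP Kz.
by rewrite f0 ?mulr0// => Kz'; apply: Kz; rewrite inE.
Qed.

Lemma integrableM_test u f : loc_integrable Omega u -> test_function Omega f ->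
  mu.-integrable Q (fun z => (u z * f z)%:E).
Proof.
move=> lu [sf [K [cK KQ f0]]].
apply: (integrableM_compact_supp lu _ cK) => // z.
exact/differentiable_continuous/(sf [::]).
Qed.

(** Lets the space and time derivatives be treated alike, as directional derivatives. *)
Lemma coord_classical_grad i :
  exists e : E, forall (f : E -> R) z, coord i (classical_grad f z) = 'D_e f z.
Proof.
case: i => [j|]; last by exists ((0, 1) : E).
by exists ((delta_mx ord0 j, 0) : E) => f' z' /=; rewrite mxE.
Qed.

Lemma integrableM_classical_grad u f i : loc_integrable Omega u ->
  test_function Omega f ->
  mu.-integrable Q (fun z => (u z * coord i (classical_grad f z))%:E).
Proof.
move=> lu [sf [K [cK KQ f0]]].
have [e De] := coord_classical_grad i.
rewrite (_ : (fun z => _) = (fun z => (u z * 'D_e f z)%:E)); last first.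
  by apply/funext => z; rewrite De.
apply: (integrableM_compact_supp lu _ cK) => // z.
  exact/differentiable_continuous/(sf [:: e]).
(* The complement of K is open, so f is zero near z and so is its derivative at z. *)
move=> Kz; rewrite (@near_eq_derive _ _ _ f (cst 0)) ?derive_cst//.
have : nbhs z (~` K).
  apply: open_nbhs_nbhs; split => //; rewrite openC.
  by apply: compact_closed => //; exact: norm_hausdorff.
by apply: filterS => y; exact: f0.
Qed.

Lemma is_weak_gradP w v : is_weak_grad Omega w v <->
  loc_integrable Omega w /\ forall i,
    loc_integrable Omega (coord i \o v) /\
    forall f, test_function Omega f ->
      \int[mu]_(z in Q) (w z * coord i (classical_grad f z)) =
      - \int[mu]_(z in Q) (coord i (v z) * f z).
Proof.
split => [[lw lv1 lv2 H]|[lw H]].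
  split => // -[j|].
    by split; [exact: lv1|move=> f /H[Hj _]; exact: Hj].
  by split; [exact: lv2|move=> f /H[_]].
split => //; [by move=> i; have [] := H (Some i)|by have [] := H None|].
move=> f tf; split => [i|]; first by have [_ /(_ _ tf)] := H (Some i).
by have [_ /(_ _ tf)] := H None.
Qed.

Lemma is_weak_gradB w w' v v' : is_weak_grad Omega w v ->
  is_weak_grad Omega w' v' ->
  is_weak_grad Omega (fun z => w z - w' z) (fun z => v z - v' z).
Proof.
move=> /is_weak_gradP[lw H] /is_weak_gradP[lw' H']; apply/is_weak_gradP.
split => [|i]; first exact: loc_integrableB.
have [lv Hv] := H i; have [lv' Hv'] := H' i; split => [|f tf].
  rewrite (_ : _ \o _ = fun z => coord i (v z) - coord i (v' z)).
    exact: loc_integrableB.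
  by apply/funext => z /=; rewrite linearB.
under eq_Rintegral do rewrite mulrBl.
rewrite RintegralB//; [|exact: integrableM_classical_grad..].
rewrite Hv// Hv'//.
under [in RHS]eq_Rintegral do rewrite linearB mulrBl.
rewrite (RintegralB mQ (integrableM_test lv tf) (integrableM_test lv' tf)).
by rewrite opprD.
Qed.

(** Each component of v - v' is orthogonal to all test functions, hence zero a.e.; the finitely many
    exceptional sets are then united. *)
Lemma weak_grad_unique w v v' :
  is_weak_grad Omega w v -> is_weak_grad Omega w v' ->
  {ae mu, forall z, Q z -> v z = v' z}.
Proof.
move=> /is_weak_gradP[lw H] /is_weak_gradP[_ H'].
have Hi i : {ae mu, forall z, Q z -> coord i (v z) - coord i (v' z) = 0}.
  have [lv Hv] := H i; have [lv' Hv'] := H' i.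
  apply: ae_eq0_cylinder => //; first exact: loc_integrableB.
  move=> f tf; under eq_Rintegral do rewrite mulrBl.
  rewrite (RintegralB mQ (integrableM_test lv tf) (integrableM_test lv' tf)).
  by apply/eqP; rewrite subr_eq0 -eqr_opp -Hv// -Hv'//.
have Hall := filter_forall (ae_filter_ringOfSetsType mu) Hi.
apply: filterS Hall => z Hz Qz.
rewrite [v z]surjective_pairing [v' z]surjective_pairing; congr pair.
  apply/rowP => j; apply/eqP; rewrite -subr_eq0; apply/eqP.
  exact: (Hz (Some j)).
by apply/eqP; rewrite -subr_eq0; apply/eqP; exact: (Hz None).
Qed.

Lemma gradP w : (exists v, is_weak_grad Omega w v) ->
  is_weak_grad Omega w (grad Omega w).
Proof. exact: getPex. Qed.

Lemma gradB w w' : (exists v, is_weak_grad Omega w v) ->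
  (exists v, is_weak_grad Omega w' v) ->
  is_weak_grad Omega (fun z => w z - w' z) (grad Omega (fun z => w z - w' z)) /\
  {ae mu, forall z, Q z ->
    grad Omega (fun z => w z - w' z) z = grad Omega w z - grad Omega w' z}.
Proof.
move=> /gradP gw /gradP gw'; have gB := is_weak_gradB gw gw'.
have gg : is_weak_grad Omega (fun z => w z - w' z)
    (grad Omega (fun z => w z - w' z)).
  by apply: gradP; eexists; exact: gB.
by split => //; exact: weak_grad_unique gg gB.
Qed.

End weak_gradient.

(** * The weighted inner product *)

(** If x or y is infinite, both differences are infinite and [fine] sends them to 0. *)
Lemma fine_subC {R : realDomainType} (x y : \bar R) :
  (0 <= x)%E -> (0 <= y)%E ->
  fine (x - y)%E = - fine (y - x)%E.
Proof. by move: x y => [x| |] [y| |] //= _ _; rewrite ?oppr0 ?opprB. Qed.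

(* Integrability is not required: if the integral of one of the parts of f is
   infinite, both sides are fine of an infinity or of oo - oo, hence 0. *)
Lemma RintegralN d (T : measurableType d) (R : realType)
    (mu : {measure set T -> \bar R}) (D : set T) (f : T -> R) :
  \int[mu]_(x in D) (- f x) = - \int[mu]_(x in D) f x.
Proof.
rewrite /Rintegral integralE [in RHS]integralE -fine_subC.
- by congr (fine (_ - _)); apply: eq_integral => x _;
    rewrite !(funeposE, funenegE) //= opprK.
- by apply: integral_ge0 => x _; exact: funeneg_ge0.
- by apply: integral_ge0 => x _; exact: funepos_ge0.
Qed.

Section dot_product.
Context {R : realType} {d : nat}.
Notation E := ('rV[R]_d * R)%type.
Implicit Types (a b c : E).

Lemma dotxtE a b : dotxt a b = \sum_(i : option 'I_d) coord i a * coord i b.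
Proof.
rewrite /dotxt /dotv [RHS](bigD1 None)//= addrC; congr (_ + _).
rewrite (reindex_omap Some id) => [|[]//]; apply: eq_bigl => j /=.
by rewrite eqxx.
Qed.

Lemma dotxtC a b : dotxt a b = dotxt b a.
Proof. by rewrite !dotxtE; apply: eq_bigr => i _; rewrite mulrC. Qed.

Lemma dotxtDl a b c : dotxt (a + b) c = dotxt a c + dotxt b c.
Proof.
rewrite !dotxtE -big_split; apply: eq_bigr => i _ /=.
by rewrite linearD mulrDl.
Qed.

Lemma dotxtZl (k : R) a b : dotxt (k *: a) b = k * dotxt a b.
Proof.
rewrite !dotxtE mulr_sumr; apply: eq_bigr => i _ /=.
by rewrite linearZ /= mulrA.
Qed.

Lemma dotxtZr (k : R) a b : dotxt a (k *: b) = k * dotxt a b.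
Proof. by rewrite dotxtC dotxtZl dotxtC. Qed.

Lemma dotxtNl a b : dotxt (- a) b = - dotxt a b.
Proof. by rewrite -scaleN1r dotxtZl mulN1r. Qed.

Lemma dotxt_sqrB a b :
  dotxt (a - b) (a - b) = dotxt a a - 2 * dotxt a b + dotxt b b.
Proof.
rewrite dotxtDl dotxtNl (dotxtC a) (dotxtC b) !dotxtDl !dotxtNl (dotxtC b a).
ring.
Qed.

Lemma dotxt_ge0 a : 0 <= dotxt a a.
Proof. by rewrite dotxtE sumr_ge0// => i _; rewrite -expr2 sqr_ge0. Qed.

(** Follows from the squares of a - b and a + b being nonnegative; the sum is written [a - - b] so
    that [dotxt_sqrB] expands both. *)
Lemma normr_dotxt_le a b : `|dotxt a b| <= dotxt a a + dotxt b b.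
Proof.
have h1 := dotxt_ge0 (a - b); have h2 := dotxt_ge0 (a - - b).
have h3 := dotxt_ge0 a; have h4 := dotxt_ge0 b.
move: h1 h2; rewrite !dotxt_sqrB (dotxtC a (- b)) !dotxtNl.
rewrite (dotxtC _ (- b)) dotxtNl (dotxtC b a) => h1 h2; rewrite ler_norml; lra.
Qed.

End dot_product.

Section weighted.
Context {R : realType} {d : nat}.
Notation E := ('rV[R]_d * R)%type.
Notation mE := ('rV[R]_d * measurableTypeR R)%type.
Notation mu := (@lebesgue_xt R d).
Context (Omega : set 'rV[R]_d) (s : R) (openOmega : open Omega).
Let Q : set mE := cylinder Omega.
Implicit Types (a b : E -> E).

Let mQ : measurable Q := measurable_cylinder openOmega.

(** Measurability is asked coordinatewise, the form in which weak gradients provide it. *)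
Definition weighted_L2 a := (forall i, measurable_fun Q (coord i \o a)) /\
  (vwnorm2 s Omega a < +oo)%E.

Definition wdot a b (z : E) : R := z.2 `^ (1 - 2 * s) * dotxt (a z) (b z).

Lemma measurable_pow (r : R) : measurable_fun Q (fun z : mE => z.2 `^ r).
Proof.
apply: measurable_funTS.
exact: (measurableT_comp (measurable_powR r) measurable_snd).
Qed.

Lemma measurable_wdot a b : (forall i, measurable_fun Q (coord i \o a)) ->
  (forall i, measurable_fun Q (coord i \o b)) ->
  measurable_fun Q (wdot a b).
Proof.
move=> ma mb; apply: measurable_funM; first exact: measurable_pow.
under eq_fun do rewrite dotxtE.
by apply: measurable_sum => i; apply: measurable_funM; [exact: ma|exact: mb].
Qed.

Lemma wdot_ge0 a z : 0 <= wdot a a z.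
Proof. by rewrite mulr_ge0 ?powR_ge0// dotxt_ge0. Qed.

Lemma integrable_wdot a b : weighted_L2 a -> weighted_L2 b ->
  mu.-integrable Q (fun z => (wdot a b z)%:E).
Proof.
move=> La Lb.
have sq c : weighted_L2 c -> mu.-integrable Q (fun z => (wdot c c z)%:E).
  move=> [mc c2]; apply/integrableP; split.
    by apply/measurable_EFinP; exact: measurable_wdot.
  under eq_integral do rewrite gee0_abs ?lee_fin ?wdot_ge0//.
  exact: c2.
apply: le_integrable (integrableD mQ (sq _ La) (sq _ Lb)) => //.
  by apply/measurable_EFinP; apply: measurable_wdot; [case: La|case: Lb].
move=> z _; rewrite lee_fin [leRHS]ger0_norm ?addr_ge0 ?wdot_ge0// /wdot normrM.
rewrite [X in X * _]ger0_norm ?powR_ge0// -mulrDr ler_wpM2l ?powR_ge0//.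
exact: normr_dotxt_le.
Qed.

(** All three terms of the expanded square are integrable, so the norm is a real number; this turns
    the energy identity into an identity between reals. *)
Lemma vwnorm2B a b : weighted_L2 a -> weighted_L2 b ->
  vwnorm2 s Omega (fun z => a z - b z) =
  (\int[mu]_(z in Q) wdot a a z - 2 * \int[mu]_(z in Q) wdot a b z +
   \int[mu]_(z in Q) wdot b b z)%:E.
Proof.
move=> La Lb; have iab := integrable_wdot La Lb.
have iaa := integrable_wdot La La; have ibb := integrable_wdot Lb Lb.
have i2ab : mu.-integrable Q (fun z => (2 * wdot a b z)%:E).
  exact: (integrableZl mQ 2 iab).
have iB : mu.-integrable Q (EFin \o (fun z => wdot a a z - 2 * wdot a b z)).
  exact: (integrableB mQ iaa i2ab).
rewrite -(RintegralZl _ mQ iab) -(RintegralB mQ iaa i2ab).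
rewrite -(RintegralD mQ iB ibb).
rewrite /Rintegral fineK; last first.
  by apply: integrable_fin_num => //; exact: (integrableD mQ iB ibb).
apply: eq_integral => z _; congr EFin.
by rewrite /wdot dotxt_sqrB; ring.
Qed.

End weighted.

(** * Orthogonality of the two errors and the energy identity *)

Theorem corollary2 (R : realType) (d : nat) (hd : (0 < d)%N)
  (Omega : set 'rV[R]_d) (hOmega : lipschitz_domain Omega)
  (s : R) (hs0 : 0 < s) (hs1 : s < 1)
  (g : 'rV[R]_d -> R) (hg : in_L2 Omega g)
  (w : 'rV[R]_d * R -> R) (hw : is_weak_solution s Omega g w)
  (wt : 'rV[R]_d * R -> R) (hwt : in_V s Omega wt)
  (y : 'rV[R]_d * R -> 'rV[R]_d * R) (hy : in_Yg s Omega g y) :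
  let p := flux s Omega w in
  let e_w := fun z => wt z - w z in
  let e_p := fun z => y z - p z in
  (vwnorm2 s Omega (grad Omega e_w) + vwnorm2 s Omega (scaled s e_p) =
   vwnorm2 s Omega (fun z => grad Omega wt z - scaled s y z)%R)%E.
Proof.
move=> p e_w e_p.
have [oO _ _ _] := hOmega.
have mQ := measurable_cylinder oO.
have [hwV hsol] := hw; have [[my Ly] _ hn] := hy.
have L2grad u : in_V s Omega u -> weighted_L2 Omega s (grad Omega u).
  move=> [[/gradP /is_weak_gradP[_ H] _ fin_u] _]; split => // i.
  by have [[]] := H i.
have LY : weighted_L2 Omega s (scaled s y).
  split => // i.
  rewrite (_ : _ \o _ =
    fun z => z.2 `^ (2 * s - 1) * coord i (y z)); last first.
    by apply/funext => z; rewrite /= linearZ.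
  apply: measurable_funM; first exact: measurable_pow.
  exact: (measurableT_comp (measurable_coord_xt i) my).
(* The two weights are reciprocal because t > 0 on Q. *)
have powK z : cylinder Omega z -> z.2 `^ (1 - 2 * s) * z.2 `^ (2 * s - 1) = 1.
  move=> [_ z0]; rewrite -powRD; last by rewrite (gt_eqF z0) implybT.
  by rewrite (_ : _ + _ = 0) ?powRr0//; ring.
have orth u : in_V s Omega u ->
  \int[lebesgue_xt R d]_(z in cylinder Omega)
    wdot s (grad Omega u) (scaled s y) z =
  \int[lebesgue_xt R d]_(z in cylinder Omega)
    wdot s (grad Omega u) (grad Omega w) z.
  move=> uV.
  transitivity (\int[lebesgue_xt R d]_(z in cylinder Omega)
    dotxt (grad Omega u z) (y z)).
    apply: eq_Rintegral => z /set_mem Qz.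
    by rewrite /wdot dotxtZr mulrA powK// mul1r.
  (* With zero divergence and normal trace -g, the trace condition says that the integral of g
     against the trace of u equals that of grad u against y; the weak equation for w gives the first
     integral another value. *)
  have := hn _ uV.
  under eq_Rintegral do rewrite mulrN.
  rewrite RintegralN => /oppr_inj.
  under [RHS]eq_Rintegral do rewrite mulr0 add0r.
  move=> <-; have /eqP := hsol _ uV; rewrite subr_eq0 => /eqP hu.
  transitivity (\int[lebesgue_rV R d]_(x in Omega) (g x * trace s Omega u x)).
    by apply: eq_Rintegral => x _; rewrite mulrC.
  by rewrite -hu; apply: eq_Rintegral => z _; rewrite /wdot dotxtC.
have LG := L2grad _ hwt; have LH := L2grad _ hwV.
have [[exwt _ _] _] := hwt; have [[exw _ _] _] := hwV.
have [/is_weak_gradP[_ mD] aeD] := gradB oO exwt exw.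
(* The chosen gradient of the difference agrees with the difference of the chosen gradients only
   a.e., which suffices under the integral. *)
have -> : vwnorm2 s Omega (grad Omega e_w) =
    vwnorm2 s Omega (fun z => grad Omega wt z - grad Omega w z).
  apply: ae_eq_integral => //.
  - have mDi i : measurable_fun (cylinder Omega) (coord i \o grad Omega e_w).
      by have [[]] := mD i.
    by apply/measurable_EFinP; exact: (measurable_wdot s mDi mDi).
  - have mB i : measurable_fun (cylinder Omega)
        (coord i \o (fun z => grad Omega wt z - grad Omega w z)).
      rewrite (_ : _ \o _ =
        (coord i \o grad Omega wt) \- (coord i \o grad Omega w)).
        have [mG _] := LG; have [mH _] := LH.
        exact: measurable_funB (mG i) (mH i).
      by apply/funext => z; rewrite /= linearB.
    by apply/measurable_EFinP; exact: (measurable_wdot s mB mB).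
  - by apply: filterS aeD => z Dz Qz; rewrite Dz.
(* The scaling undoes the weight in the flux: t^(2s-1) p = grad w at every point of Q. *)
have -> : vwnorm2 s Omega (scaled s e_p) =
    vwnorm2 s Omega (fun z => scaled s y z - grad Omega w z).
  apply: eq_integral => z /set_mem Qz.
  rewrite /scaled /e_p /p /flux scalerBr scalerA.
  by rewrite [X in X *: grad _ _ _]mulrC powK// scale1r.
rewrite (vwnorm2B oO LG LH) (vwnorm2B oO LY LH) (vwnorm2B oO LG LY).
have -> : \int[lebesgue_xt R d]_(z in cylinder Omega)
    wdot s (scaled s y) (grad Omega w) z =
  \int[lebesgue_xt R d]_(z in cylinder Omega)
    wdot s (grad Omega w) (grad Omega w) z.
  by rewrite -(orth _ hwV); apply: eq_Rintegral => z _; rewrite /wdot dotxtC.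
rewrite (orth _ hwt) -EFinD.
(* In the notation of the overview only (G, G), (G, H), (H, H) and (Y, Y) are left, and the (H, H)
   terms cancel. *)
by do 4 move: (Rintegral _ _ _) => ?; congr EFin; ring.
Qed.
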